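(* Let $Z\in\mathbb{R}^{n\times m}$ satisfy $Z^TZ=I$. If Bischof-Stewart pivoting is applied to compute a pivoted QR factorization of $Z^T\in\mathbb{R}^{m\times n}$ (run for $m$ steps), then the set $\mathcal{C}\subset\{1,\ldots,n\}$ of the $m$ columns of $Z^T$ selected as pivots satisfies \[ \sigma_i(Z(\mathcal{C},:))\;\geq\; \frac{1}{\sqrt{1+\frac{i(n-m)}{m-i+1}}} \] for $i=1,\ldots,m$.
   Context: $\sigma_1\ge\sigma_2\ge\cdots$ denote singular values in non-increasing order. $Z(\mathcal{C},:)$ is the $m\times m$ submatrix of $Z$ consisting of the rows indexed by $\mathcal{C}$ (equivalently, the transpose of the selected columns of $Z^T$). Exact arithmetic is assumed. Bischof-Stewart pivoting, applied to a matrix $A\in\mathbb{R}^{m\times n}$: columns are selected one at a time. Suppose $i$ columns have been selected, $0\le i<\min(m,n)$, and let $\Pi$ be a permutation matrix that moves the selected columns, in the order of selection, to the first $i$ positions. Write the partial QR factorization \[ A\Pi = \begin{bmatrix}Q_1 & Q_2\end{bmatrix}\begin{bmatrix}R_{11} & R_{12}\\ 0 & M\end{bmatrix}, \] with $\begin{bmatrix}Q_1 & Q_2\end{bmatrix}$ an $m\times m$ orthogonal matrix, $R_{11}\in\mathbb{R}^{i\times i}$ upper triangular, $R_{12}\in\mathbb{R}^{i\times(n-i)}$, and $M\in\mathbb{R}^{(m-i)\times(n-i)}$ (no structure is imposed on $M$). The next pivot is the column of $A\Pi$ in position $i+j$, where $j\in\{1,\ldots,n-i\}$ minimizes \[ \frac{1+\|R_{11}^{-1}R_{12}e_j\|_2^2}{\|Me_j\|_2^2}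 \] over all $j$ with $Me_j\neq 0$; here $e_j$ is the $j$-th standard basis vector. By convention, when $i=0$ the numerator is $1$, so the first pivot is a column of $A$ of largest Euclidean norm. Ties are broken arbitrarily. *)

(* Defs.v *)
From HB Require Import structures.
From mathcomp Require Import all_boot all_order all_algebra all_fingroup.
From mathcomp Require Import polyrcf.
From mathcomp Require Import reals.

Set Implicit Arguments.
Unset Strict Implicit.
Unset Printing Implicit Defensive.

Import Order.TTheory GRing.Theory Num.Theory.

Local Open Scope ring_scope.

Definition roots_with_mult (R : rcfType) (p : {poly R}) : seq R :=
  flatten [seq nseq (mup x p) x | x <- rootsR p].

(* The square roots of the eigenvalues of A^T A, counted with multiplicity.
   All n of them are kept, so for m < n the list ends with n - m zeros. *)
Definition singular_values (R : rcfType) (m n : nat) (A : 'M[R]_(m, n)) :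
    seq R :=
  sort (fun x y => y <= x)
    [seq Num.sqrt x | x <- roots_with_mult (char_poly (A^T *m A))].

(* Numbered from 1: sigma A 1 is the largest singular value. *)
Definition sigma (R : rcfType) (m n : nat) (A : 'M[R]_(m, n)) (i : nat) : R :=
  (singular_values A)`_i.-1.

Definition norm2 (R : rcfType) (m : nat) (v : 'cV[R]_m) : R :=
  Num.sqrt (\sum_k v k 0 ^+ 2).

(* The rows of Z indexed by C, in increasing order of the index. *)
Definition rows_of (R : rcfType) (m n : nat) (Z : 'M[R]_(n, m))
    (C : {set 'I_n}) : 'M[R]_(#|C|, m) :=
  rowsub (fun k : 'I_#|C| => enum_val k) Z.

(* col_perm s A is A *m perm_mx s^-1: its column k is column s k of A.
   The casts identify 'M_(i + p, i + q) with 'M_(m, n); is_trig_mx means lower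
   triangular, hence the transpose. *)
Definition partial_qr (R : rcfType) (m n i p q : nat)
    (hm : (i + p = m)%N) (hn : (i + q = n)%N) (A : 'M[R]_(m, n)) (s : 'S_n)
    (Q : 'M[R]_m) (R11 : 'M[R]_i) (R12 : 'M[R]_(i, q)) (M : 'M[R]_(p, q)) :
    Prop :=
  [/\ Q^T *m Q = 1%:M,
      is_trig_mx R11^T &
      col_perm s A = Q *m castmx (hm, hn) (block_mx R11 R12 0 M)].

(* When i = 0 the product invmx R11 *m R12 has no rows and the numerator is 1.
   R11 is invertible whenever the columns already selected are linearly
   independent, which the condition col j M != 0 on pivots guarantees. *)
Definition bs_ratio (R : rcfType) (i p q : nat) (R11 : 'M[R]_i)
    (R12 : 'M[R]_(i, q)) (M : 'M[R]_(p, q)) (j : 'I_q) : R :=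
  (1 + norm2 (col j (invmx R11 *m R12)) ^+ 2) / norm2 (col j M) ^+ 2.

Definition bs_minimizer (R : rcfType) (i p q : nat) (R11 : 'M[R]_i)
    (R12 : 'M[R]_(i, q)) (M : 'M[R]_(p, q)) (j : 'I_q) : Prop :=
  col j M != 0 /\
  forall k : 'I_q, col k M != 0 -> bs_ratio R11 R12 M j <= bs_ratio R11 R12 M k.

(* x may be selected after the columns c. The ratios depend neither on the
   permutation nor on the factorization, so any one of them may be used. *)
Variant bs_next (R : rcfType) (m n : nat) (A : 'M[R]_(m, n)) (c : seq 'I_n)
    (x : 'I_n) : Prop :=
  BSNext (p q : nat) (hm : (size c + p = m)%N) (hn : (size c + q = n)%N)
    (s : 'S_n) (Q : 'M[R]_m) (R11 : 'M[R]_(size c))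
    (R12 : 'M[R]_(size c, q)) (M : 'M[R]_(p, q)) (j : 'I_q) of
    (size c < minn m n)%N &
    (forall k : 'I_(size c),
        s (cast_ord hn (lshift q k)) = tnth (in_tuple c) k) &
    partial_qr hm hn A s Q R11 R12 M &
    bs_minimizer R11 R12 M j &
    x = s (cast_ord hn (rshift (size c) j)).

(* c lists, in order of selection, the pivots chosen by size c steps; ties are
   broken arbitrarily, so several c of a given size may qualify. *)
Inductive bs_pivots (R : rcfType) (m n : nat) (A : 'M[R]_(m, n)) :
    seq 'I_n -> Prop :=
| BSNil : bs_pivots A [::]
| BSRcons (c : seq 'I_n) (x : 'I_n) :
    bs_pivots A c -> bs_next A c x -> bs_pivots A (rcons c x).

(* Main.v *)
Require Import Defs.
From mathcomp Require Import all_boot all_order all_algebra all_fingroup.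
From mathcomp Require Import polyrcf complex ring lra.
From mathcomp Require Import reals.

Set Implicit Arguments.
Unset Strict Implicit.

Import Order.TTheory GRing.Theory Num.Theory.
Local Open Scope ring_scope.

(** Let [A = Z^T], so that [A A^T = 1], let [B_i] be the matrix of the first [i]
    pivot columns of [A], [X_i] its pseudoinverse and [|.|] the Frobenius norm.

    Appending a column [a] to [B_i] increases [|X_i|^2] by exactly
    [(1 + |X_i a|^2) / |a - B_i X_i a|^2] ([pinv_append]).  In terms of the
    partial QR factorization this is the quotient minimized by the pivoting
    rule.  Since [A A^T = 1], over the columns not yet selected the numerators
    sum to [n - 2 i + |X_i|^2] and the denominators to [m - i], so the least
    quotient is at most the quotient of the two sums ([greedy_step]).  The
    resulting recurrence gives [|X_i|^2 <= i (n - i + 1) / (m - i + 1)]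
    ([bs_pinv_bound]).

    The columns of [X_i A] with selected indices form an identity matrix, and
    the others have total squared norm [|X_i|^2 - i].  Hence, for [x] in the
    column space of [B_i], [|x|^2 <= (1 + |X_i|^2 - i) |B_i^T x|^2]
    ([pinv_lower_bound]), and [1 + |X_i|^2 - i <= 1 + i (n - m) / (m - i + 1)].

    If [W] consists of the selected rows of [Z], then
    [|W x|^2 >= |B_i^T x|^2], because the first [i] pivots are distinct and are
    among the selected indices.  So [|W x|^2 >= |x|^2 / tau] on a space of
    dimension [i], where [tau = 1 + i (n - m) / (m - i + 1)], and the
    Courant-Fischer principle ([count_eigenvalues_ge]) shows that [i]
    eigenvalues of [W^T W] are at least [1 / tau]. *)

(** * Pseudoinverses and the squared Frobenius norm *)

(** [is_pinv B X]: [B] has full column rank and [X] is its Moore-Penrose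
    pseudoinverse, characterized as the left inverse of [B] whose rows lie in
    the column space of [B]. *)
Definition is_pinv (R : rcfType) (m i : nat) (B : 'M[R]_(m, i))
    (X : 'M[R]_(i, m)) : Prop :=
  X *m B = 1%:M /\ exists Y : 'M_i, X = Y *m B^T.

(** The squared Frobenius norm; on a row or a column vector it is the squared
    Euclidean norm. *)
Definition fnorm2 (R : rcfType) (m n : nat) (A : 'M[R]_(m, n)) : R :=
  \tr (A *m A^T).

Lemma fnorm2E (R : rcfType) (m n : nat) (A : 'M[R]_(m, n)) :
  fnorm2 A = \sum_i \sum_j A i j ^+ 2.
Proof.
apply: eq_bigr => i _; rewrite mxE; apply: eq_bigr => j _.
by rewrite mxE expr2.
Qed.

Lemma fnorm2_ge0 (R : rcfType) (m n : nat) (A : 'M[R]_(m, n)) : 0 <= fnorm2 A.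
Proof. by rewrite fnorm2E; do 2!apply: sumr_ge0 => ? _; exact: sqr_ge0. Qed.

Lemma fnorm2_eq0 (R : rcfType) (m n : nat) (A : 'M[R]_(m, n)) :
  (fnorm2 A == 0) = (A == 0).
Proof.
apply/idP/eqP => [|->]; last by rewrite /fnorm2 mul0mx mxtrace0.
rewrite fnorm2E psumr_eq0 => [/allP Ai0|? _]; last first.
  by apply: sumr_ge0 => ? _; exact: sqr_ge0.
apply/matrixP=> i j; rewrite mxE; apply/eqP.
have := Ai0 i (mem_index_enum _).
rewrite psumr_eq0 => [/allP Aij0|? _]; last exact: sqr_ge0.
by have := Aij0 j (mem_index_enum _); rewrite sqrf_eq0.
Qed.

Lemma fnorm2_tr (R : rcfType) (m n : nat) (A : 'M[R]_(m, n)) :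
  fnorm2 A^T = fnorm2 A.
Proof. by rewrite /fnorm2 trmxK mxtrace_mulC. Qed.

Lemma fnorm2_col (R : rcfType) (m n : nat) (A : 'M[R]_(m, n)) :
  fnorm2 A = \sum_j fnorm2 (col j A).
Proof.
rewrite fnorm2E exchange_big; apply: eq_bigr => j _; rewrite fnorm2E.
by apply: eq_bigr => i _; rewrite big_ord1 mxE.
Qed.

Lemma fnorm2_row_mx (R : rcfType) (m n1 n2 : nat) (A : 'M[R]_(m, n1))
    (B : 'M[R]_(m, n2)) :
  fnorm2 (row_mx A B) = fnorm2 A + fnorm2 B.
Proof. by rewrite /fnorm2 tr_row_mx mul_row_col mxtraceD. Qed.

Lemma fnorm2_col_mx (R : rcfType) (m1 m2 n : nat) (A : 'M[R]_(m1, n))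
    (B : 'M[R]_(m2, n)) :
  fnorm2 (col_mx A B) = fnorm2 A + fnorm2 B.
Proof.
by rewrite -fnorm2_tr tr_col_mx fnorm2_row_mx !fnorm2_tr.
Qed.

Lemma fnorm2_isometryl (R : rcfType) (m n p : nat) (Q : 'M[R]_(p, m))
    (A : 'M[R]_(m, n)) :
  Q^T *m Q = 1%:M -> fnorm2 (Q *m A) = fnorm2 A.
Proof.
move=> QQ; rewrite /fnorm2 trmx_mul mxtrace_mulC !mulmxA -(mulmxA _ Q^T).
by rewrite QQ mulmx1 mxtrace_mulC.
Qed.

Lemma fnorm2_isometryr (R : rcfType) (m n p : nat) (A : 'M[R]_(m, n))
    (Q : 'M[R]_(n, p)) :
  Q *m Q^T = 1%:M -> fnorm2 (A *m Q) = fnorm2 A.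
Proof.
by move=> QQ; rewrite -fnorm2_tr trmx_mul fnorm2_isometryl ?fnorm2_tr ?trmxK.
Qed.

Lemma fnorm2_pythagoras (R : rcfType) (m n : nat) (A B : 'M[R]_(m, n)) :
  A *m B^T = 0 -> fnorm2 (A + B) = fnorm2 A + fnorm2 B.
Proof.
move=> AB; rewrite /fnorm2 linearD /= mulmxDr !mulmxDl !mxtraceD AB linear0.
by rewrite -[B *m A^T]trmxK trmx_mul trmxK AB trmx0 linear0 addr0 add0r.
Qed.

Lemma norm2_sqr (R : rcfType) (m : nat) (v : 'cV[R]_m) :
  norm2 v ^+ 2 = fnorm2 v.
Proof.
rewrite /norm2 sqr_sqrtr; last by apply: sumr_ge0 => ? _; exact: sqr_ge0.
by rewrite fnorm2E; apply: eq_bigr => k _; rewrite big_ord1.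
Qed.

(** [B X] is the orthogonal projector onto the column space of [B], so [B^T]
    does not see the residuals [a - B X a]. *)
Lemma trmx_mul_pinv (R : rcfType) (m i : nat) (B : 'M[R]_(m, i))
    (X : 'M[R]_(i, m)) :
  is_pinv B X -> B^T *m (B *m X) = B^T.
Proof.
case=> XB [Y XE]; have : Y *m (B^T *m B) = 1%:M by rewrite mulmxA -XE.
by move=> /mulmx1C GY; rewrite XE !mulmxA GY mul1mx.
Qed.

(** The pseudoinverse after appending a column [a] outside the column space of
    [B].  The increase of its squared Frobenius norm is exactly the quotient
    that Bischof-Stewart pivoting minimizes, so the pivoting is a greedy
    algorithm for this norm. *)
Lemma pinv_append (R : rcfType) (m i : nat) (B : 'M[R]_(m, i))
    (X : 'M[R]_(i, m)) (a : 'cV[R]_m) :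
  is_pinv B X -> a - B *m (X *m a) != 0 ->
  exists2 X' : 'M[R]_(i + 1, m), is_pinv (row_mx B a) X' &
    fnorm2 X' =
      fnorm2 X + (1 + fnorm2 (X *m a)) / fnorm2 (a - B *m (X *m a)).
Proof.
move=> pX; set w := a - _; rewrite -fnorm2_eq0 => w0.
have [XB [Y XE]] := pX.
have BTw : B^T *m w = 0.
  by rewrite /w mulmxBr (mulmxA B) mulmxA trmx_mul_pinv // subrr.
have wTB : w^T *m B = 0 by rewrite -[LHS]trmxK trmx_mul trmxK BTw trmx0.
have wTw : w^T *m w = (fnorm2 w)%:M.
  by rewrite /fnorm2 mxtrace_mulC trace_mx11 -mx11_scalar.
have wTa : w^T *m a = (fnorm2 w)%:M.
  by rewrite -wTw {3}/w mulmxBr (mulmxA _ B) wTB mul0mx subr0.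
(* v is the dual vector of a: it annihilates B and takes the value 1 on a. *)
pose v := (fnorm2 w)^-1 *: w^T.
have vB : v *m B = 0 by rewrite -scalemxAl wTB scaler0.
have va : v *m a = 1%:M by rewrite -scalemxAl wTa scale_scalar_mx mulVf.
have Xv : X *m v^T = 0.
  by rewrite XE linearZ /= trmxK -scalemxAr -mulmxA BTw mulmx0 scaler0.
have vv : v *m v^T = (fnorm2 w)^-1%:M.
  rewrite linearZ /= trmxK -scalemxAl -scalemxAr wTw !scale_scalar_mx.
  by rewrite mulVf // mulr1.
exists (col_mx (X - X *m a *m v) v).
  split.
    rewrite mul_col_row !mulmxBl XB -!(mulmxA _ v) vB va mulmx0 mulmx1.
    by rewrite subr0 subrr -scalar_mx_block.
  pose Yv : 'M_(1, i + 1) := (fnorm2 w)^-1 *: row_mx (- (X *m a)^T) 1%:M.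
  have vE : v = Yv *m col_mx B^T a^T.
    rewrite /v /Yv -scalemxAl mul_row_col mul1mx mulNmx addrC.
    by rewrite -trmx_mul -linearB.
  exists (col_mx (row_mx Y 0 - X *m a *m Yv) Yv); rewrite tr_row_mx.
  rewrite mul_col_mx mulmxBl -[X *m a *m Yv *m _]mulmxA -vE.
  by rewrite mul_row_col mul0mx addr0 -XE.
rewrite fnorm2_col_mx {2}/fnorm2 vv mxtrace_scalar mulr1n.
rewrite fnorm2_pythagoras; last first.
  by rewrite linearN /= trmx_mul mulmxN mulmxA Xv mul0mx oppr0.
have -> : fnorm2 (- (X *m a *m v)) = fnorm2 (X *m a) / fnorm2 w.
  rewrite /fnorm2 linearN /= mulNmx mulmxN opprK trmx_mul mulmxA.
  by rewrite -(mulmxA _ v) vv mul_mx_scalar -scalemxAl mxtraceZ mulrC.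
ring.
Qed.

(** * One step of the pivoting *)

Lemma pinv_qr (R : rcfType) (i p : nat) (Q : 'M[R]_(i + p)) (R11 : 'M[R]_i)
    (X : 'M[R]_(i, i + p)) :
  Q^T *m Q = 1%:M -> is_pinv (Q *m col_mx R11 0) X ->
  R11 \in unitmx /\ X = row_mx (invmx R11) 0 *m Q^T.
Proof.
move=> QQ [XB [Y XE]].
have XE' : X = row_mx (Y *m R11^T) 0 *m Q^T.
  by rewrite XE trmx_mul tr_col_mx trmx0 mulmxA mul_mx_row mulmx0.
have YR : Y *m R11^T *m R11 = 1%:M.
  move: XB; rewrite XE' -mulmxA (mulmxA Q^T) QQ mul1mx mul_row_col.
  by rewrite mul0mx addr0.
have [_ R11u] := mulmx1_unit YR; split=> //.
by rewrite XE' -[Y *m _](mulmxK R11u) YR mul1mx.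
Qed.

(** If the block triangular matrix [T] has orthonormal rows, then so has [M],
    and [R11 R11^T + R12 R12^T = 1] evaluates the sum of the squared norms of
    the columns of [R11^-1 R12]. *)
Lemma coisometry_blocks (R : rcfType) (i p q : nat) (R11 : 'M[R]_i)
    (R12 : 'M[R]_(i, q)) (M : 'M[R]_(p, q)) :
  block_mx R11 R12 0 M *m (block_mx R11 R12 0 M)^T = 1%:M ->
  R11 \in unitmx ->
  fnorm2 M = p%:R /\
  fnorm2 (invmx R11) = i%:R + fnorm2 (invmx R11 *m R12).
Proof.
rewrite tr_block_mx mulmx_block scalar_mx_block.
move=> /eq_block_mx[R11E _ _]; rewrite trmx0 mul0mx add0r => ME R11u.
split; first by rewrite /fnorm2 ME mxtrace1.
rewrite /fnorm2 -[i%:R](@mxtrace1 R) -mxtraceD; congr (\tr _).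
rewrite trmx_mul !mulmxA -(mulmxA (invmx R11) R12).
have -> : R12 *m R12^T = 1%:M - R11 *m R11^T by rewrite -R11E addrC addKr.
rewrite mulmxBr mulmx1 mulmxA mulVmx // mul1mx mulmxBl -trmx_mul mulVmx //.
by rewrite trmx1 addrC subrK.
Qed.

(** One pivoting step adds to the squared norm of the pseudoinverse at most the
    average increment.  Over the [q] remaining columns the numerators of the
    quotients sum to [q + (fnorm2 X - i)] and the denominators to [p]; the
    minimal quotient is at most the quotient of these sums. *)
Lemma greedy_step (R : rcfType) (m n i p q : nat) (hm : (i + p = m)%N)
    (hn : (i + q = n)%N) (A : 'M[R]_(m, n)) (s : 'S_n) (Q : 'M[R]_m)
    (R11 : 'M[R]_i) (R12 : 'M[R]_(i, q)) (M : 'M[R]_(p, q)) (j : 'I_q)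
    (B : 'M[R]_(m, i)) (X : 'M[R]_(i, m)) :
  A *m A^T = 1%:M -> partial_qr hm hn A s Q R11 R12 M ->
  bs_minimizer R11 R12 M j ->
  B = colsub (fun k => s (cast_ord hn (lshift q k))) A -> is_pinv B X ->
  exists2 X' : 'M[R]_(i + 1, m),
    is_pinv (row_mx B (col (s (cast_ord hn (rshift i j))) A)) X' &
    p%:R * fnorm2 X' <= p%:R * fnorm2 X + (q%:R - i%:R + fnorm2 X).
Proof.
case: m / hm Q A B X => Q A B X; case: n / hn s A => s A.
move=> AA [QQ _]; rewrite castmx_id => AE [Mj0 Mjmin] BE pX.
set a := col _ A.
set T := block_mx R11 R12 0 M in AE.
have BQ : B = Q *m col_mx R11 0.
  have -> : B = lsubmx (col_perm s A).
    by rewrite BE; apply/matrixP=> k l; rewrite !mxE cast_ord_id.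
  by rewrite AE /T -mulmx_lsub block_mxEh row_mxKl.
have aQ : a = Q *m col_mx (col j R12) (col j M).
  have -> : a = col j (rsubmx (col_perm s A)).
    by apply/matrixP=> k l; rewrite !mxE cast_ord_id.
  rewrite AE /T -mulmx_rsub block_mxEh row_mxKr.
  by rewrite colE -mulmxA -colE col_col_mx.
have [R11u XE] : R11 \in unitmx /\ X = row_mx (invmx R11) 0 *m Q^T.
  by apply: pinv_qr QQ _; rewrite -BQ.
have QQ' : Q *m Q^T = 1%:M by apply: mulmx1C.
have TT : T *m T^T = 1%:M.
  have -> : T = Q^T *m col_perm s A by rewrite AE mulmxA QQ mul1mx.
  rewrite col_permE !trmx_mul trmxK !mulmxA -(mulmxA _ (perm_mx _)).
  by rewrite tr_perm_mx -perm_mxM mulgV perm_mx1 mulmx1 -(mulmxA Q^T) AA mulmx1.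
have [Mp XS] := coisometry_blocks TT R11u.
have FX : fnorm2 X = fnorm2 (invmx R11).
  rewrite XE fnorm2_isometryr ?trmxK // fnorm2_row_mx.
  by rewrite [X in _ + X](_ : _ = 0) ?addr0 //; apply/eqP; rewrite fnorm2_eq0.
rewrite -FX in XS.
have Xa : X *m a = col j (invmx R11 *m R12).
  rewrite XE aQ -mulmxA (mulmxA Q^T) QQ mul1mx mul_row_col mul0mx addr0.
  by rewrite !colE mulmxA.
have wE : a - B *m (X *m a) = Q *m col_mx 0 (col j M).
  rewrite Xa BQ aQ -mulmxA -mulmxBr mul_col_mx mul0mx opp_col_mx add_col_mx.
  by rewrite oppr0 addr0 !colE mulmxA mulKVmx // subrr.
have Fw : fnorm2 (a - B *m (X *m a)) = fnorm2 (col j M).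
  rewrite wE fnorm2_isometryl // fnorm2_col_mx.
  by rewrite [X in X + _](_ : _ = 0) ?add0r //; apply/eqP; rewrite fnorm2_eq0.
have [|X' pX' FX'] := pinv_append pX (a := a).
  by rewrite -fnorm2_eq0 Fw fnorm2_eq0.
exists X' => //; rewrite FX' Fw Xa mulrDr lerD2l.
have -> : q%:R - i%:R + fnorm2 X =
    \sum_(k < q) (1 + fnorm2 (col k (invmx R11 *m R12))).
  rewrite big_split /= sumr_const card_ord -fnorm2_col XS; ring.
rewrite -Mp fnorm2_col mulr_suml; apply: ler_sum => k _.
(* A column with col k M = 0 adds to the numerators but not to the
   denominators. *)
have [Mk0|Mk0] := eqVneq (col k M) 0.
  have /eqP -> : fnorm2 (col k M) == 0 by rewrite fnorm2_eq0 Mk0.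
  by rewrite mul0r addr_ge0 ?fnorm2_ge0.
have := Mjmin k Mk0; rewrite /bs_ratio !norm2_sqr => ratio_le.
rewrite [fnorm2 (col k M) * _]mulrC.
rewrite -ler_pdivlMr //.
by rewrite lt_def fnorm2_eq0 Mk0 fnorm2_ge0.
Qed.

(** * The pseudoinverse of the selected columns *)

(** The columns of [A] listed by [c], in the order of selection. *)
Definition pivot_cols (R : rcfType) (m n : nat) (A : 'M[R]_(m, n))
    (c : seq 'I_n) : 'M[R]_(m, size c) :=
  colsub (tnth (in_tuple c)) A.

Lemma is_pinv_castmx (R : rcfType) (m i k : nat) (e : i = k)
    (B : 'M[R]_(m, i)) (X : 'M[R]_(i, m)) :
  is_pinv B X -> is_pinv (castmx (erefl m, e) B) (castmx (e, erefl m) X).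
Proof. by case: k / e => pX; rewrite !castmx_id. Qed.

Lemma fnorm2_castmx (R : rcfType) (m n m' n' : nat) (em : m = m') (en : n = n')
    (A : 'M[R]_(m, n)) : fnorm2 (castmx (em, en) A) = fnorm2 A.
Proof. by case: m' / em; case: n' / en; rewrite castmx_id. Qed.

Lemma pivot_cols_rcons (R : rcfType) (m n : nat) (A : 'M[R]_(m, n))
    (c : seq 'I_n) (x : 'I_n) (e : (size c + 1)%N = size (rcons c x)) :
  pivot_cols A (rcons c x) =
    castmx (erefl m, e) (row_mx (pivot_cols A c) (col x A)).
Proof.
apply/matrixP=> k l; rewrite castmxE !mxE /= cast_ord_id.
rewrite (tnth_nth x) /= nth_rcons.
case: splitP => [l'|l'] /= ->; first by rewrite ltn_ord mxE (tnth_nth x).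
by rewrite ord1 addn0 ltnn eqxx mxE.
Qed.

(** With [i = size c], the bound [F_i = i (n - i + 1) / (m - i + 1)] solves the
    recurrence [F_(i+1) = F_i + (n - 2 i + F_i) / (m - i)], [F_0 = 0], given by
    the averaging estimate of a single step. *)
Lemma bs_pinv_bound (R : rcfType) (m n : nat) (A : 'M[R]_(m, n))
    (c : seq 'I_n) :
  A *m A^T = 1%:M -> bs_pivots A c ->
  exists2 X : 'M[R]_(size c, m), is_pinv (pivot_cols A c) X &
    fnorm2 X <= (size c)%:R * (n%:R - (size c)%:R + 1)
                  / (m%:R - (size c)%:R + 1).
Proof.
move=> AA; elim=> [|{}c x _ [X pX FX]].
  exists 0; last by rewrite mul0r mul0r /fnorm2 mul0mx mxtrace0.
  by split; [apply/matrixP=> -[] | exists 0; rewrite mul0mx].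
case=> p q hm hn s Q R11 R12 M j ltc sc qr jmin xE.
have BE : pivot_cols A c = colsub (fun k => s (cast_ord hn (lshift q k))) A.
  by apply/matrixP=> k l; rewrite !mxE sc.
have [X' pX' FX'] := greedy_step AA qr jmin BE pX.
rewrite -xE in pX'.
have e : (size c + 1)%N = size (rcons c x) by rewrite size_rcons addn1.
exists (castmx (e, erefl m) X').
  by rewrite (pivot_cols_rcons _ e); apply: is_pinv_castmx.
rewrite fnorm2_castmx size_rcons.
have p0 : 0 < p%:R :> R.
  rewrite ltr0n -(ltn_add2l (size c)) addn0 hm.
  by move: ltc; rewrite leq_min => /andP[].
have mE : m%:R = (size c)%:R + p%:R :> R by rewrite -natrD hm.
have nE : n%:R = (size c)%:R + q%:R :> R by rewrite -natrD hn.
rewrite mE nE in FX *; rewrite -natr1.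
set r := (size c)%:R in FX FX' *; set P := p%:R in p0 FX FX' *.
have {}FX : fnorm2 X * (P + 1) <= r * (q%:R + 1).
  move: FX; have addKl y : r + y - r = y by ring.
  by rewrite !addKl ler_pdivlMr //; lra.
have -> : r + P - (r + 1) + 1 = P by ring.
rewrite ler_pdivlMr // mulrC (le_trans FX') //.
nra.
Qed.

Lemma bs_pivots_take (R : rcfType) (m n : nat) (A : 'M[R]_(m, n))
    (c : seq 'I_n) (k : nat) : bs_pivots A c -> bs_pivots A (take k c).
Proof.
move=> pc; elim: pc k => [|{}c x pc IH next_x] k; first exact: BSNil.
have [lek|ltk] := leqP k (size c); first by rewrite -cats1 takel_cat.
by rewrite take_oversize ?size_rcons //; apply: BSRcons.
Qed.

Lemma fnorm2_mul_le (R : rcfType) (n p : nat) (y : 'rV[R]_n)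
    (S : 'M[R]_(n, p)) :
  fnorm2 (y *m S) <= fnorm2 y * fnorm2 S.
Proof.
(* Column by column, this is the Cauchy-Schwarz inequality. *)
suff CS (v : 'cV[R]_n) : fnorm2 (y *m v) <= fnorm2 y * fnorm2 v.
  rewrite fnorm2_col [fnorm2 S]fnorm2_col mulr_sumr; apply: ler_sum => j _.
  by rewrite colE -mulmxA -colE.
set d := (y *m v) 0 0; set N := fnorm2 y; set V := fnorm2 v.
have dE : y *m v = d%:M by rewrite -mx11_scalar.
have -> : fnorm2 (y *m v) = d ^+ 2 by rewrite fnorm2E !big_ord1.
have : 0 <= fnorm2 (V *: y - d *: v^T) by exact: fnorm2_ge0.
rewrite /fnorm2 [(_ - _)^T]linearB /=.
rewrite [(V *: y)^T]linearZ [(d *: _)^T]linearZ /=.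
rewrite trmxK mulmxBr !mulmxBl.
rewrite -!scalemxAl -!scalemxAr !scalerA dE.
have -> : v^T *m y^T = d%:M by rewrite -trmx_mul dE tr_scalar_mx.
have -> : \tr (V * V *: (y *m y^T) - d * V *: d%:M -
     (V * d *: d%:M - d * d *: (v^T *m v))) = V * (N * V - d ^+ 2).
  have yy : \tr (y *m y^T) = N by [].
  have vv : \tr (v^T *m v) = V by rewrite mxtrace_mulC.
  by rewrite !linearB /= !mxtraceZ !mxtrace_scalar mulr1n yy vv; ring.
have [V0|V0] := eqVneq V 0.
  move: dE; have /eqP -> : v == 0 by rewrite -fnorm2_eq0 -/V V0.
  rewrite mulmx0 => /matrixP/(_ 0 0); rewrite !mxE eqxx mulr1n => <-.
  by rewrite V0 mulr0 expr0n.
by rewrite pmulr_rge0 ?subr_ge0 // lt_def V0 fnorm2_ge0.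
Qed.

Lemma fnorm2_colsub (R : rcfType) (m n i : nat) (A : 'M[R]_(m, n))
    (f : 'I_i -> 'I_n) :
  injective f -> fnorm2 A =
    fnorm2 (colsub f A) + \sum_(j | j \notin codom f) fnorm2 (col j A).
Proof.
move=> injf; rewrite fnorm2_col (bigID (mem (codom f))) /=; congr (_ + _).
rewrite -big_uniq ?big_image; last by apply/injectiveP.
by rewrite fnorm2_col; apply: eq_bigr => k _; rewrite col_colsub.
Qed.

Lemma left_inverse_injective (R : rcfType) (m n i : nat) (A : 'M[R]_(m, n))
    (f : 'I_i -> 'I_n) (X : 'M[R]_(i, m)) :
  X *m colsub f A = 1%:M -> injective f.
Proof.
move=> XB k l fkl; apply/eqP; apply: contraT => nkl.
have /matrixP/(_ k l) := XB; have /matrixP/(_ k k) := XB.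
rewrite !mxE eqxx (negPf nkl) => XBkk XBkl.
suff /eqP : 1 = 0 :> R by rewrite oner_eq0.
rewrite -[LHS]XBkk -[RHS]XBkl; apply: eq_bigr => h _.
by rewrite !mxE fkl.
Qed.

(** As [A A^T = 1], the matrix [X A] has the norm of [X]; its columns indexed by
    [f] form the identity. *)
Lemma fnorm2_pinv_excess (R : rcfType) (m n i : nat) (A : 'M[R]_(m, n))
    (f : 'I_i -> 'I_n) (X : 'M[R]_(i, m)) :
  A *m A^T = 1%:M -> X *m colsub f A = 1%:M ->
  fnorm2 X - i%:R = \sum_(j | j \notin codom f) fnorm2 (col j (X *m A)).
Proof.
move=> AA XB; rewrite -(fnorm2_isometryr X AA).
rewrite (fnorm2_colsub _ (left_inverse_injective XB)) -mulmx_colsub XB.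
by rewrite [fnorm2 1%:M]/fnorm2 mul1mx trmx1 mxtrace1 addrAC subrr add0r.
Qed.

Lemma size_le_fnorm2_left_inverse (R : rcfType) (m n i : nat) (A : 'M[R]_(m, n))
    (f : 'I_i -> 'I_n) (X : 'M[R]_(i, m)) :
  A *m A^T = 1%:M -> X *m colsub f A = 1%:M -> i%:R <= fnorm2 X.
Proof.
move=> AA XB; rewrite -subr_ge0 (fnorm2_pinv_excess AA XB).
by apply: sumr_ge0 => j _; exact: fnorm2_ge0.
Qed.

(** A lower bound on the least singular value of the matrix [B] of selected
    columns.  A row vector [x] in the row space of [B^T] satisfies [x = y X]
    with [y = x B], so that [|x|^2 = |y X A|^2], where [X A] consists of an
    identity block and of columns whose squared norms sum to [|X|^2 - i].  The
    factor [1 + |X|^2 - i] so obtained improves on the factor [|X|^2] of the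
    direct estimate of [|y X|]. *)
Lemma pinv_lower_bound (R : rcfType) (m n i : nat) (A : 'M[R]_(m, n))
    (f : 'I_i -> 'I_n) (X : 'M[R]_(i, m)) (v : 'rV[R]_i) (x : 'rV[R]_m) :
  A *m A^T = 1%:M -> is_pinv (colsub f A) X ->
  x = v *m (colsub f A)^T ->
  fnorm2 x <= (1 + (fnorm2 X - i%:R)) * fnorm2 (x *m colsub f A).
Proof.
move=> AA pX xv; set B := colsub f A; set y := x *m B.
have [XB _] := pX.
have xE : x = y *m X.
  by rewrite /y xv -{1}(trmx_mul_pinv pX) !mulmxA.
have injf := left_inverse_injective XB.
have XAB : colsub f (X *m A) = 1%:M by rewrite -XB mulmx_colsub.
rewrite (fnorm2_pinv_excess AA XB).
rewrite {1}xE -(fnorm2_isometryr _ AA) -mulmxA (fnorm2_colsub _ injf).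
rewrite -mulmx_colsub XAB mulmx1 mulrDl mul1r lerD2l mulr_suml.
apply: ler_sum => j _; rewrite [leRHS]mulrC (_ : col j _ = y *m col j (X *m A)).
  exact: fnorm2_mul_le.
by rewrite !colE !mulmxA.
Qed.

Lemma fnorm2_rows_of_ge (R : rcfType) (m n i : nat) (Z : 'M[R]_(n, m))
    (f : 'I_i -> 'I_n) (C : {set 'I_n}) (x : 'rV[R]_m) :
  injective f -> (forall k, f k \in C) ->
  fnorm2 (x *m colsub f Z^T) <= fnorm2 (x *m (rows_of Z C)^T).
Proof.
move=> injf fC.
have -> : (rows_of Z C)^T = colsub (fun k : 'I_#|C| => enum_val k) Z^T.
  by apply/matrixP=> k l; rewrite !mxE.
rewrite !mulmx_colsub fnorm2_col [leRHS]fnorm2_col.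
pose F j := fnorm2 (col j (x *m Z^T)).
rewrite (eq_bigr (fun k => F (f k))) => [|k _]; last by rewrite col_colsub.
rewrite [leRHS](eq_bigr (fun k => F (enum_val k))) => [|k _]; last first.
  by rewrite col_colsub.
rewrite -(big_enum_val F).
have -> : \sum_k F (f k) = \sum_(j in codom f) F j.
  by rewrite -big_uniq ?big_image //; apply/injectiveP.
rewrite [leRHS](bigID (mem (codom f))) /=.
rewrite (eq_bigl (fun j => (j \in C) && (j \in codom f))) => [|j].
  by rewrite lerDl; apply: sumr_ge0 => j _; exact: fnorm2_ge0.
by rewrite andb_idl // => /codomP[k ->].
Qed.

(** * Eigenvalues of real symmetric matrices *)

Local Open Scope sesquilinear_scope.

Lemma char_poly_conj (F : fieldType) (n : nat) (P A : 'M[F]_n) :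
  P \in unitmx -> char_poly (invmx P *m A *m P) = char_poly A.
Proof.
move=> Pu; set B := _ *m P; pose PX := map_mx (@polyC F) P.
have PB : P *m B = A *m P by rewrite /B !mulmxA mulmxV // mul1mx.
have detPX : \det PX != 0.
  by rewrite /PX det_map_mx polyC_eq0 -unitfE -unitmxE.
apply: (mulfI detPX); rewrite [RHS]mulrC /char_poly -!det_mulmx.
congr (\det _); rewrite /char_poly_mx mulmxBr mulmxBl.
by rewrite -!map_mxM PB scalar_mxC.
Qed.

Lemma roots_with_mult_prod_XsubC (R : rcfType) (s : seq R) :
  perm_eq (roots_with_mult (\prod_(x <- s) ('X - x%:P))) s.
Proof.
set p := \prod_(x <- s) _.
have p0 : p != 0 by rewrite monic_neq0 // monic_prod_XsubC.
have rootsE : perm_eq (undup s) (rootsR p).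
  apply: uniq_perm; rewrite ?undup_uniq ?uniq_roots // => x.
  by rewrite mem_undup -(roots_on_rootsR p0) inE root_prod_XsubC.
apply: perm_trans (perm_count_undup s); rewrite perm_sym /roots_with_mult.
rewrite (eq_map (g := fun x => nseq (mup x p) x)) => [|x].
  exact/perm_flatten/perm_map.
by rewrite mu_prod_XsubC.
Qed.

(** The eigenvalues [d] are real, and the diagonalizing matrix [P] is taken
    unitary over the complex extension of [R]. *)
Lemma symmetric_spectral (R : rcfType) (n : nat) (H : 'M[R]_n) :
  H^T = H ->
  exists (P : 'M[complex R]_n) (d : 'rV[R]_n),
    [/\ P \is unitarymx,
        map_mx (real_complex R) H =
          P^t* *m diag_mx (map_mx (real_complex R) d) *m P &
        char_poly H = \prod_(x <- [seq d 0 k | k : 'I_n]) ('X - x%:P)].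
Proof.
move=> symH; set HC := map_mx _ H.
have HCherm : HC \is hermsymmx.
  apply: realsym_hermsym.
    apply/is_hermitianmxP; rewrite expr0 scale1r map_mx_id //.
    by rewrite /HC map_trmx symH.
  by apply/mxOverP=> i j; rewrite mxE complex_real.
have /orthomx_spectralP HCE := hermitian_normalmx HCherm.
have /mxOverP spR := hermitian_spectral_diag_real HCherm.
set P := spectralmx HC in HCE; set sp := spectral_diag HC in HCE spR.
have PU : P \is unitarymx by apply: spectral_unitarymx.
pose d := map_mx (@complex.Re R) sp.
have dE : map_mx (real_complex R) d = sp.
  by apply/rowP=> k; rewrite !mxE RRe_real.
exists P, d; split=> //; first by rewrite dE -invmx_unitary.
apply: (map_poly_inj (real_complex R)).
rewrite map_char_poly -/HC HCE char_poly_conj ?unitarymx_unit //.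
rewrite char_poly_trig ?diag_mx_is_trig // -dE big_map big_enum /= rmorph_prod.
by apply: eq_bigr => k _; rewrite rmorphB /= map_polyX map_polyC !mxE eqxx.
Qed.

(** A real positive semidefinite form stays so over complex vectors, as its
    value at [a + i b] is the sum of its values at [a] and [b]. *)
Lemma psd_complex (R : rcfType) (n : nat) (N : 'M[R]_n) :
  N^T = N -> (forall v : 'rV_n, 0 <= (v *m N *m v^T) 0 0) ->
  forall u : 'rV[complex R]_n,
    0 <= (u *m map_mx (real_complex R) N *m u^t*) 0 0.
Proof.
move=> symN psdN u.
pose rc := real_complex R.
pose a := map_mx (@complex.Re R) u; pose b := map_mx (@complex.Im R) u.
have uE : u = map_mx rc a + 'i%C *: map_mx rc b.
  by apply/rowP=> k; rewrite !mxE; exact: complexE.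
have utE : u^t* = map_mx rc a^T - 'i%C *: map_mx rc b^T.
  apply/colP=> k; rewrite !mxE; case: (u 0 k) => x y.
  apply/eqP; rewrite eq_complex /= !(mul0r, mul1r, subr0, addr0, oppr0).
  by rewrite !(sub0r, add0r) !eqxx.
have cross : b *m N *m a^T = a *m N *m b^T.
  have tr11 (X : 'M[R]_1) : X^T = X by apply/matrixP=> i j; rewrite !ord1 mxE.
  by rewrite -[LHS]tr11 !trmx_mul trmxK symN mulmxA.
rewrite utE uE mulmxDl mulmxDl !mulmxBr -!scalemxAl -!scalemxAr -!map_mxM cross.
have -> : forall X Y W : 'M[R]_1,
    map_mx rc X - 'i%C *: map_mx rc Y +
      ('i%C *: map_mx rc Y - 'i%C *: ('i%C *: map_mx rc W)) =
    map_mx rc (X + W).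
  move=> X Y W; rewrite scalerA -expr2 sqr_i scaleN1r opprK map_mxD addrA.
  by rewrite subrK.
by rewrite mxE ler0c mxE addr_ge0.
Qed.

(** The half of the Courant-Fischer principle that bounds eigenvalues from
    below: if the form of [H] is at least [t] times the squared norm on the
    row space of [K], of dimension [i], then [i] eigenvalues of [H], counted
    with multiplicity, are at least [t]. *)
Lemma count_eigenvalues_ge (R : rcfType) (n i : nat) (H : 'M[R]_n)
    (K : 'M[R]_(i, n)) (t : R) :
  H^T = H -> row_free K ->
  (forall v : 'rV_i,
      t * (v *m K *m (v *m K)^T) 0 0 <= (v *m K *m H *m (v *m K)^T) 0 0) ->
  exists2 s : seq R,
    char_poly H = \prod_(x <- s) ('X - x%:P) & (i <= count (>= t) s)%N.
Proof.
move=> symH Kfree HK.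
have [P [d [PU HE charE]]] := symmetric_spectral symH.
exists [seq d 0 k | k : 'I_n] => //.
pose rc := real_complex R.
pose N := K *m H *m K^T - t *: (K *m K^T).
have symN : N^T = N.
  by rewrite /N linearB linearZ /= !trmx_mul !trmxK symH mulmxA.
have psdN (v : 'rV_i) : 0 <= (v *m N *m v^T) 0 0.
  have := HK v; rewrite -subr_ge0 !trmx_mul.
  rewrite /N mulmxBr mulmxBl -scalemxAr -scalemxAl !mulmxA.
  by rewrite !mxE.
pose J := [set k | t <= d 0 k].
have -> : count (>= t) [seq d 0 k | k : 'I_n] = #|J|.
  rewrite count_map cardE /J -size_filter enumT /enum_mem -enumT.
  by congr size; apply: eq_filter => k; rewrite !inE.
rewrite leqNgt; apply/negP => ltJi.
pose KP := map_mx rc K *m P^t*.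
pose L := colsub (fun k : 'I_#|J| => enum_val k) KP.
(* With fewer than i eigenvalues >= t, some nonzero vector of the complex row
   space of K has no component on their eigenvectors. *)
have : kermx L != 0.
  rewrite kermx_eq0 /row_free neq_ltn.
  by rewrite (leq_ltn_trans (rank_leq_col L) ltJi).
case/rowV0Pn => u /sub_kermxP uL u0.
pose z := u *m KP.
have zJ k : t <= d 0 k -> z 0 k = 0.
  move=> tk; have kJ : k \in J by rewrite inE.
  have /rowP/(_ (enum_rank_in kJ k)) := uL.
  rewrite [RHS]mxE => <-; rewrite [LHS]mxE [RHS]mxE; apply: eq_bigr => l _.
  by rewrite [L _ _]mxE enum_rankK_in.
have PtU : P^t* *m P = 1%:M by apply: mulmx1C; apply/unitarymxP.
have zP : z *m P = u *m map_mx rc K by rewrite /z /KP -!mulmxA PtU mulmx1.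
have z0 : z != 0.
  apply: contraNneq u0 => z0; apply/eqP.
  have Kf : row_free (map_mx rc K) by rewrite row_free_map.
  by apply: (row_free_inj Kf); rewrite -zP z0 !mul0mx.
have := psd_complex symN psdN u.
have -> : u *m map_mx rc N *m u^t* =
    z *m diag_mx (map_mx rc (d - const_mx t)) *m z^t*.
  have KtE : (map_mx rc K)^t* = map_mx rc K^T.
    by apply/matrixP=> k l; rewrite !mxE; exact: conjc_real.
  have diagE : diag_mx (map_mx rc (d - const_mx t)) =
      diag_mx (map_mx rc d) - (rc t)%:M.
    rewrite map_mxB linearB /=; congr (_ - _).
    by rewrite -diag_const_mx; congr diag_mx; apply/rowP=> k; rewrite !mxE.
  have zPt : P^t* *m z^t* = map_mx rc K^T *m u^t*.
    by rewrite -KtE -!map_mxM -!trmx_mul zP.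
  have zdz : z *m diag_mx (map_mx rc d) *m z^t* =
      u *m map_mx rc K *m map_mx rc H *m map_mx rc K^T *m u^t*.
    rewrite HE -zP -[RHS]mulmxA -zPt !mulmxA.
    have /unitarymxP PPt := PU.
    rewrite -[_ *m P *m P^t*]mulmxA PPt mulmx1.
    by rewrite -[_ *m P *m P^t*]mulmxA PPt mulmx1.
  have zz : z *m z^t* = u *m map_mx rc K *m map_mx rc K^T *m u^t*.
    rewrite -zP -[RHS]mulmxA -zPt !mulmxA.
    have /unitarymxP PPt := PU.
    by rewrite -[_ *m P *m P^t*]mulmxA PPt mulmx1.
  rewrite diagE mulmxBr mulmxBl zdz mul_mx_scalar -scalemxAl zz.
  rewrite /N map_mxB map_mxZ !map_mxM mulmxBr mulmxBl.
  by rewrite -scalemxAr -scalemxAl !mulmxA.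
(* On that vector the form of H - t is nonnegative, yet it is a sum of
   nonpositive terms, so all of them vanish. *)
clearbody z; pose f k := rc (t - d 0 k) * `|z 0 k| ^+ 2.
have f_ge0 k : true -> 0 <= f k.
  move=> _.
  have [tk|dk] := leP t (d 0 k); first by rewrite /f zJ // normr0 expr0n mulr0.
  by rewrite mulr_ge0 ?exprn_ge0 // ler0c subr_ge0 ltW.
rewrite mxE (eq_bigr (fun k => - f k)) => [|k _]; last first.
  rewrite mul_mx_diag; rewrite [z^t* _ _]mxE mxE [z^T _ _]mxE !mxE.
  by rewrite /f normCK mulrA -mulNr -mulNr -rmorphN opprB [z 0 k * _]mulrC.
rewrite sumrN oppr_ge0 => sum_le0.
have /psumr_eq0P f0 : \sum_k f k = 0.
  by apply: le_anti; rewrite sum_le0 sumr_ge0.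
case/negP: z0; apply/eqP/rowP => k; rewrite [RHS]mxE.
have [/zJ //|dk] := leP t (d 0 k).
have /eqP := f0 f_ge0 k isT; rewrite mulf_eq0 fmorph_eq0 subr_eq0 gt_eqF //=.
by rewrite expf_eq0 /= normr_eq0 => /eqP.
Qed.

(** * Singular values *)

Lemma nth_sort_ge_count (R : realDomainType) (s : seq R) (u : R) (i : nat) :
  (0 < i <= count (>= u) s)%N -> u <= (sort (fun x y => y <= x) s)`_i.-1.
Proof.
case: i => //= i lti; set s' := sort _ s.
have ss : sorted (fun x y => y <= x) s'.
  by apply: sort_sorted => x y; exact: le_total.
have trs : transitive (fun x y : R => y <= x).
  by move=> y x w yx; move/le_trans; apply.
have cs : count (>= u) s' = count (>= u) s.
  by have /seq.permP := permEl (perm_sort (fun x y => y <= x) s); exact.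
have si : (i < size s')%N by rewrite (leq_trans _ (count_size (>= u) s')) ?cs.
rewrite leNgt; apply/negP => ltu.
move: lti; rewrite -cs -(cat_take_drop i s') count_cat.
rewrite [X in (_ + X)%N](_ : _ = 0%N) ?addn0; last first.
  apply/eqP; rewrite -leqn0 leqNgt -has_count; apply/hasPn => x xs /=.
  rewrite -ltNge; apply: le_lt_trans ltu.
  have := ss; rewrite -{1}(cat_take_drop i s') => /cat_sorted2[_].
  rewrite (drop_nth 0) //= path_sortedE // => /andP[/allP sx _].
  by move: xs; rewrite (drop_nth 0) // inE => /orP[/eqP-> //|/sx].
by rewrite ltnNge (leq_trans (count_size _ _)) // size_take si.
Qed.

Lemma sigma_ge (R : rcfType) (m n i : nat) (W : 'M[R]_(m, n))
    (K : 'M[R]_(i, n)) (t : R) :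
  (0 < i)%N -> row_free K ->
  (forall v : 'rV_i, t * (v *m K *m (v *m K)^T) 0 0
     <= (v *m K *m (W^T *m W) *m (v *m K)^T) 0 0) ->
  Num.sqrt t <= sigma W i.
Proof.
move=> i0 Kfree HK; have symH : (W^T *m W)^T = W^T *m W.
  by rewrite trmx_mul trmxK.
have [s charE si] := count_eigenvalues_ge symH Kfree HK.
apply: nth_sort_ge_count; rewrite i0 (leq_trans si) // charE count_map.
have /seq.permP -> := roots_with_mult_prod_XsubC s.
by apply: sub_count => x /= /ler_wsqrtr.
Qed.

Close Scope sesquilinear_scope.
Unset Implicit Arguments.

Theorem theorem3p1 (R : realType) (n m : nat) (Z : 'M[R]_(n, m))
    (hZ : Z^T *m Z = 1%:M) (c : seq 'I_n)
    (hc : bs_pivots Z^T c) (hsize : size c = m)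
    (i : nat) (hi : (1 <= i <= m)%N) :
  sigma (rows_of Z [set x in c]) i
    >= 1 / Num.sqrt (1 + i%:R * (n%:R - m%:R) / (m%:R - i%:R + 1)).
Proof.
have AA : Z^T *m Z^T^T = 1%:M by rewrite trmxK.
case/andP: hi => i0 im.
set c' := take i c; have sc' : size c' = i by rewrite size_takel ?hsize.
(* Only the first i pivots enter the bound on the i-th singular value. *)
have [X pX FX] := bs_pinv_bound AA (bs_pivots_take i hc).
rewrite -/c' in X pX FX; set B := pivot_cols Z^T c' in pX.
set f := tnth (in_tuple c').
have injf : injective f by have [XB _] := pX; exact: left_inverse_injective XB.
set tau := 1 + _.
have FXtau : 1 + (fnorm2 X - (size c')%:R) <= tau.
  rewrite lerD2l (le_trans (lerD FX (lexx _))) // sc'.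
  have d0 : 0 < m%:R - i%:R + 1 :> R by rewrite ltr_wpDl // subr_ge0 ler_nat.
  rewrite -[X in _ - X](mulfK (lt0r_neq0 d0)) -mulrBl.
  by rewrite ler_pM2r ?invr_gt0 // le_eqVlt; apply/orP; left; apply/eqP; ring.
have tau0 : 0 < tau.
  rewrite (lt_le_trans _ FXtau) // ltr_pwDl // subr_ge0.
  by have [XB _] := pX; exact: size_le_fnorm2_left_inverse AA XB.
have -> : 1 / Num.sqrt tau = Num.sqrt tau^-1 by rewrite sqrtrV ?ltW // mul1r.
have Bfree : row_free B^T.
  apply/row_freeP; exists X^T; rewrite -trmx_mul.
  by have [-> _] := pX; rewrite trmx1.
rewrite -sc' in i0 *.
apply: (sigma_ge i0 Bfree) => v; set x := v *m B^T.
have -> : (x *m x^T) 0 0 = fnorm2 x by rewrite /fnorm2 trace_mx11.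
set W := rows_of _ _.
have -> : (x *m (W^T *m W) *m x^T) 0 0 = fnorm2 (x *m W^T).
  by rewrite /fnorm2 trace_mx11 [(x *m W^T)^T]trmx_mul trmxK !mulmxA.
rewrite mulrC ler_pdivrMr // mulrC.
apply: le_trans (pinv_lower_bound AA pX (erefl x)) _.
apply: (le_trans (ler_wpM2r (fnorm2_ge0 _) FXtau)).
apply: (ler_wpM2l (ltW tau0)); apply: (fnorm2_rows_of_ge Z x injf) => k.
by rewrite inE (mem_take (mem_tnth k (in_tuple c'))).
Qed.
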